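(* Let $P$ be a finite bounded poset with $|P|>1$, let $\mathfrak{A}(P)$ be the lattice of all antichains of $P$, let $\mathfrak{b}:\mathfrak{A}(P)\to\mathfrak{A}(P)$ be the blocker map, and let $\mathfrak{B}(P)=\mathfrak{b}(\mathfrak{A}(P))$ be its image, equipped with the partial order induced from $\mathfrak{A}(P)$. Then the poset $\mathfrak{B}(P)$ is a lattice with least element $\hat{0}_{\mathfrak{B}(P)}=\emptyset$ (the empty antichain of $P$) and greatest element $\hat{1}_{\mathfrak{B}(P)}=\{\hat{0}_P\}$. The unique atom of $\mathfrak{B}(P)$ is $\mathfrak{b}(P^{\mathrm a})$, and the unique coatom of $\mathfrak{B}(P)$ is $P^{\mathrm a}$. Moreover: (i) the poset $\mathfrak{B}(P)$ is a meet-subsemilattice of the lattice $\mathfrak{A}(P)$; (ii) the lattice $\mathfrak{B}(P)$ is self-dual (isomorphic to its order dual); (iii) in the lattice $\mathfrak{B}(P)$ the operations of meet and join are determined as follows: for $B_1,B_2\in\mathfrak{B}(P)$, $$B_1\wedge_{\mathfrak{B}(P)}B_2=B_1\wedge_{\mathfrak{A}(P)}B_2$$ and $$B_1\vee_{\mathfrak{B}(P)}B_2=\mathfrak{b}\bigl(\mathfrak{b}(B_1)\wedge_{\mathfrak{A}(P)}\mathfrak{b}(B_2)\bigr).$$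
   Context: A poset $P$ is bounded if it has a unique minimal (least) element $\hat{0}_P$ and a unique maximal (greatest) element $\hat{1}_P$. $P^{\mathrm a}$ denotes the set of atoms of $P$ (elements covering $\hat{0}_P$). For $x\in P$, $\mathfrak{I}_P(x)=\{y\in P: y\le x\}$; for $X\subseteq P$, $\mathfrak{F}_P(X)=\{y\in P: y\ge x \text{ for some } x\in X\}$ is the order filter generated by $X$. $\mathbf{min}\,Q$ denotes the set of minimal elements of a poset $Q$. Lattice of antichains: $\mathfrak{A}(P)$ is the set of all antichains of $P$, including the empty antichain, ordered by $A_1\le_{\mathfrak{A}(P)}A_2$ if and only if $\mathfrak{F}_P(A_1)\subseteq\mathfrak{F}_P(A_2)$. It is a lattice (isomorphic to the lattice of order filters of $P$ ordered by inclusion), with $A_1\vee_{\mathfrak{A}(P)}A_2=\mathbf{min}(A_1\cup A_2)$ and $A_1\wedge_{\mathfrak{A}(P)}A_2=\mathbf{min}\bigl(\mathfrak{F}_P(A_1)\cap\mathfrak{F}_P(A_2)\bigr)$. Intersecters: let $A\subseteq P$. If $A\neq\emptyset$ and $A\neq\{\hat{0}_P\}$, an element $b\in P$ is an intersecter for $A$ in $P$ if for every $a\in A-\{\hat{0}_P\}$ one has $|\mathfrak{I}_P(b)\cap\mathfrak{I}_P(a)\cap P^{\mathrm a}|\ge 1$. If $A=\{\hat{0}_P\}$, then $A$ has no intersecters in $P$. If $A=\emptyset$, then every element of $P$ is an intersecter for $A$ in $P$. The set of all intersecters for $A$ in $P$, regarded as a subposet of $P$, is denoted $\mathbf{I}(P,A)$.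 Blocker map: $\mathfrak{b}(A)=\mathbf{min}\,\mathbf{I}(P,A)$ for $A\in\mathfrak{A}(P)$; in particular $\mathfrak{b}(\emptyset)=\{\hat{0}_P\}$ and $\mathfrak{b}(\{\hat{0}_P\})=\emptyset$. *)

(* Defs.v *)
From HB Require Import structures.
From mathcomp Require Import all_boot all_order.

Set Implicit Arguments.
Unset Strict Implicit.
Unset Printing Implicit Defensive.

Import Order.TTheory.
Local Open Scope order_scope.

Section PosetNotions.
Context {d : Order.disp_t} {T : porderType d}.
Implicit Types x y z m : T.

Definition is_least x := forall y, x <= y.

Definition is_greatest x := forall y, y <= x.

Definition is_meet x y m :=
  [/\ m <= x, m <= y & forall z, z <= x -> z <= y -> z <= m].

Definition is_join x y m :=
  [/\ x <= m, y <= m & forall z, x <= z -> y <= z -> m <= z].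

End PosetNotions.

Definition is_lattice {d : Order.disp_t} (T : porderType d) :=
  forall x y : T, (exists m, is_meet x y m) /\ (exists j, is_join x y j).

Definition self_dual {d : Order.disp_t} (T : porderType d) :=
  exists f : T -> T^d, bijective f /\ {mono f : x y / x <= y}.

Definition covers {d : Order.disp_t} {T : finPOrderType d} (x y : T) : bool :=
  (x < y) && [forall z : T, ~~ (x < z < y)].

Section FinPoset.
Context {d : Order.disp_t} {T : finPOrderType d}.
Implicit Types (A X : {set T}) (x y : T).

Definition order_ideal x : {set T} := [set y | y <= x].

Definition order_filter X : {set T} := [set y | [exists x in X, x <= y]].

Definition minset X : {set T} := [set x in X | [forall y in X, ~~ (y < x)]].

Definition is_antichain A : bool :=
  [forall x in A, forall y in A, (x >=< y) ==> (x == y)].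

Lemma minset_antichain X : is_antichain (minset X).
Proof.
apply/forall_inP => x; rewrite inE => /andP[xX /forall_inP minx].
apply/forall_inP => y; rewrite inE => /andP[yX /forall_inP miny].
apply/implyP; have := minx y yX; have := miny x xX.
by case: comparableP.
Qed.

Lemma filter_subset X Y :
  (order_filter X \subset order_filter Y) =
  [forall x in X, x \in order_filter Y].
Proof.
apply/subsetP/forall_inP => [sXY x xX|sXY z].
  by apply: sXY; rewrite inE; apply/exists_inP; exists x.
rewrite inE => /exists_inP[x xX xz].
have := sXY x xX; rewrite !inE => /exists_inP[y yY yx].
by apply/exists_inP; exists y => //; apply: le_trans xz.
Qed.

Lemma minset_below X x : x \in X -> exists2 y, y \in minset X & y <= x.
Proof.
move: {2}#|_|.+1 (ltnSn #|[set y in X | y < x]|) => n.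
elim: n x => // n IHn x; rewrite ltnS => le_n xX.
case: (boolP [forall y in X, ~~ (y < x)]) => [minx|].
  by exists x; rewrite // inE xX.
rewrite negb_forall_in => /exists_inP[y yX]; rewrite negbK => yx.
have [|z zm zy] := IHn y _ yX; last first.
  by exists z => //; apply: le_trans zy (ltW yx).
apply: leq_trans le_n; apply: proper_card; apply/properP; split.
  by apply/subsetP => z; rewrite !inE => /andP[-> /lt_trans->].
by exists y; rewrite !inE yX ?yx ?ltxx.
Qed.

Lemma order_filter_minset X : order_filter (minset X) = order_filter X.
Proof.
apply/eqP; rewrite eqEsubset !filter_subset; apply/andP; split.
  apply/forall_inP => x; rewrite inE => /andP[xX _].
  by rewrite inE; apply/exists_inP; exists x.
by apply/forall_inP => x /minset_below[y ym yx]; rewrite inE; apply/exists_inP; exists y.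
Qed.

Lemma order_filterU X Y :
  order_filter (X :|: Y) = order_filter X :|: order_filter Y.
Proof.
apply/setP => z; rewrite !inE; apply/exists_inP/orP => [[x]|].
  by rewrite inE => /orP[xX|xY] xz; [left|right]; apply/exists_inP; exists x.
by case=> /exists_inP[x xX xz]; exists x; rewrite // inE xX ?orbT.
Qed.

Lemma order_filter_filterI X Y :
  order_filter (order_filter X :&: order_filter Y) =
  order_filter X :&: order_filter Y.
Proof.
apply/setP => z; apply/idP/idP => [|zXY]; last first.
  by rewrite inE; apply/exists_inP; exists z.
rewrite !inE => /exists_inP[x]; rewrite !inE.
move=> /andP[/exists_inP[u uX ux] /exists_inP[v vY vx]] xz.
by apply/andP; split; apply/exists_inP;
  [exists u | exists v]; rewrite // (le_trans _ xz).
Qed.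

End FinPoset.

(* The subtype carries its own order, hence a type distinct from {set T}. *)
Record antichain {d : Order.disp_t} (T : finPOrderType d) := Antichain {
  antichain_set :> {set T};
  _ : is_antichain antichain_set }.

Fact antichain_display : Order.disp_t. Proof. exact: Order.Disp tt tt. Qed.

HB.instance Definition _ (d : Order.disp_t) (T : finPOrderType d) :=
  [isSub for @antichain_set d T].
HB.instance Definition _ (d : Order.disp_t) (T : finPOrderType d) :=
  [Finite of antichain T by <:].

Section AntichainLattice.
Context {d : Order.disp_t} {T : finPOrderType d}.
Implicit Types A B C : antichain T.

Definition min_antichain (X : {set T}) : antichain T :=
  Antichain (minset_antichain X).

Definition antichain_le A B : bool := order_filter A \subset order_filter B.

Definition antichain_meet A B : antichain T :=
  min_antichain (order_filter A :&: order_filter B).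

Definition antichain_join A B : antichain T := min_antichain (A :|: B).

Fact antichain_le_refl : reflexive antichain_le.
Proof. by move=> A; apply: subxx. Qed.

Fact antichain_le_anti : antisymmetric antichain_le.
Proof.
have sub A B : antichain_le A B -> antichain_le B A -> A \subset B.
  rewrite /antichain_le !filter_subset => /forall_inP AB /forall_inP BA.
  apply/subsetP => x xA; have := AB x xA; rewrite inE => /exists_inP[y yB yx].
  have := BA y yB; rewrite inE => /exists_inP[z zA zy].
  have /forall_inP/(_ z zA)/forall_inP/(_ x xA)/implyP acA := valP A.
  have zx : z = x by apply/eqP/acA; rewrite /Order.comparable (le_trans zy yx).
  suff -> : x = y by [].
  by apply/eqP; rewrite eq_le yx -{1}zx zy.
move=> A B /andP[AB BA]; apply/val_inj/eqP.
by rewrite eqEsubset !sub.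
Qed.

Fact antichain_le_trans : transitive antichain_le.
Proof. by move=> A B C; apply: subset_trans. Qed.

HB.instance Definition _ :=
  Order.Le_isPOrder.Build antichain_display (antichain T)
    antichain_le_refl antichain_le_anti antichain_le_trans.

Fact antichain_meetP A B C :
  (A <= antichain_meet B C) = (A <= B) && (A <= C).
Proof.
change (antichain_le A (antichain_meet B C) =
        antichain_le A B && antichain_le A C).
by rewrite /antichain_le order_filter_minset order_filter_filterI subsetI.
Qed.

Fact antichain_joinP A B C :
  (antichain_join A B <= C) = (A <= C) && (B <= C).
Proof.
change (antichain_le (antichain_join A B) C =
        antichain_le A C && antichain_le B C).
by rewrite /antichain_le order_filter_minset order_filterU subUset.
Qed.

HB.instance Definition _ :=
  Order.POrder_MeetJoin_isLattice.Build antichain_display (antichain T)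
    antichain_meetP antichain_joinP.

Lemma antichain_leE A B :
  (A <= B) = (order_filter A \subset order_filter B).
Proof. by []. Qed.

Lemma antichain_meetE A B :
  A `&` B = min_antichain (order_filter A :&: order_filter B).
Proof. by []. Qed.

Lemma antichain_joinE A B : A `|` B = min_antichain (A :|: B).
Proof. by []. Qed.

End AntichainLattice.

Section Blocker.
Context {d : Order.disp_t} {P : finTBPOrderType d}.

Definition atoms : {set P} := [set x | covers \bot x].

Definition intersecter (A : {set P}) (b : P) : bool :=
  if A == set0 then true
  else if A == [set \bot] then false
  else [forall a in A :\ \bot,
          (1 <= #|order_ideal b :&: order_ideal a :&: atoms|)%N].

Definition intersecters (A : {set P}) : {set P} := [set b | intersecter A b].

Definition blocker (A : antichain P) : antichain P :=
  min_antichain (intersecters A).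

Fact set0_antichain : is_antichain (set0 : {set P}).
Proof. by apply/forall_inP => x; rewrite inE. Qed.

Fact bot_antichain : is_antichain [set \bot : P].
Proof.
by apply/forall_inP => x /set1P->; apply/forall_inP => y /set1P->; rewrite eqxx implybT.
Qed.

Fact atoms_antichain : is_antichain atoms.
Proof.
have nlt x y : x \in atoms -> y \in atoms -> ~~ (x < y).
  rewrite !inE => /andP[x0 _] /andP[_ /forallP/(_ x)].
  by rewrite x0.
apply/forall_inP => x xA; apply/forall_inP => y yA; apply/implyP.
by have := nlt x y xA yA; have := nlt y x yA xA; case: comparableP.
Qed.

Definition empty_antichain : antichain P := Antichain set0_antichain.

Definition bottom_antichain : antichain P := Antichain bot_antichain.

Definition atom_antichain : antichain P := Antichain atoms_antichain.

End Blocker.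

(* The image of the blocker map, with the order induced by [val]. *)
Definition blockers {d : Order.disp_t} (P : finTBPOrderType d) :=
  {B : antichain P | B \in codom (@blocker d P)}.

HB.instance Definition _ (d : Order.disp_t) (P : finTBPOrderType d) :=
  SubFinite.on (blockers P).
HB.instance Definition _ (d : Order.disp_t) (P : finTBPOrderType d) :=
  [SubChoice_isSubPOrder of blockers P by <: with antichain_display].

Definition blocker_in {d : Order.disp_t} {P : finTBPOrderType d}
  (A : antichain P) : blockers P :=
  exist _ (blocker A) (codom_f blocker A).

Lemma le_blockersE {d : Order.disp_t} {P : finTBPOrderType d}
  (B1 B2 : blockers P) : (B1 <= B2) = (val B1 <= val B2).
Proof. by []. Qed.

(* Main.v *)
Require Import Defs.
From mathcomp Require Import all_boot all_order.
Import Order.TTheory.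
Local Open Scope order_scope.

(** The blocker map is a self-adjoint antitone Galois connection, and the
theorem is the standard theory of such a map.

Call two elements of [P] linked when some atom lies below both.  This relation
is symmetric, and it is preserved when either element increases.  The cases in
the definition of an intersecter collapse on antichains: [b] intersects [A]
exactly when [b] is linked to every element of [A] ([mem_intersecters]).  Hence
the intersecters of [A] form an up-set, which is the filter generated by
[blocker A], and [A <= blocker B] says that all elements of [A] are linked to
all elements of [B].  That condition is symmetric in [A] and [B], which gives
[le_blockerC].  Consequently [blocker] reverses the order and sends joins to
meets, it is an involution on its image, and the image is closed under meets;
conjugating the meet by this involution gives the join.

For the extreme elements, every antichain other than the top [{\bot}] consists
of nonbottom elements, each of which lies above an atom, so the atoms form the
unique coatom of the lattice of all antichains ([le_atom_antichain]).  They are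
moreover a blocker, and dualising through [blocker] gives the unique atom. *)

(** * Unique covers of an extreme element *)

Lemma covers_least {d : Order.disp_t} {T : finPOrderType d} (o a x : T) :
  is_least o -> o < a -> (forall y, y != o -> a <= y) ->
  covers o x <-> x = a.
Proof.
move=> leo oa lea; split=> [/andP[ox /forallP/(_ a)]|->].
  have ax : a <= x by apply: lea; rewrite gt_eqF.
  by rewrite oa lt_neqAle ax andbT negbK => /eqP.
apply/andP; split=> //; apply/forallP => z; apply/negP => /andP[oz za].
by have := lt_le_trans za (lea z (negbT (gt_eqF oz))); rewrite ltxx.
Qed.

Lemma covers_greatest {d : Order.disp_t} {T : finPOrderType d} (i c x : T) :
  is_greatest i -> c < i -> (forall y, y != i -> y <= c) ->
  covers x i <-> x = c.
Proof.
move=> gei ci gec; split=> [/andP[xi /forallP/(_ c)]|->].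
  have xc : x <= c by apply: gec; rewrite lt_eqF.
  by rewrite ci andbT lt_neqAle xc andbT negbK => /eqP.
apply/andP; split=> //; apply/forallP => z; apply/negP => /andP[cz zi].
by have := le_lt_trans (gec z (negbT (lt_eqF zi))) cz; rewrite ltxx.
Qed.

Section Blockers.
Context {d : Order.disp_t} {P : finTBPOrderType d}.
Implicit Types (x y : P) (A B : antichain P).

(** * Elements with a common atom *)

Definition linked x y := [exists a in atoms, (a <= x) && (a <= y)].

Lemma linkedC x y : linked x y = linked y x.
Proof. by apply: eq_existsb => a; rewrite (andbC (a <= x)). Qed.

Lemma linked_le x x' y : x <= x' -> linked x y -> linked x' y.
Proof.
move=> xx' /exists_inP[a aA /andP[ax ay]].
by apply/exists_inP; exists a; rewrite ?ay ?(le_trans ax xx').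
Qed.

Lemma linkedx0 x : linked x \bot = false.
Proof.
apply/exists_inP => -[a]; rewrite inE => /andP[a0 _] /andP[_ a0'].
by have := lt_le_trans a0 a0'; rewrite ltxx.
Qed.

Lemma ex_atom x : x != \bot -> exists2 a, a \in atoms & a <= x.
Proof.
rewrite -lt0x => x0.
have /minset_below[a] : x \in [set y | \bot < y] by rewrite inE.
rewrite !inE => /andP[a0 /forall_inP mina] ax; exists a => //.
rewrite inE; apply/andP; split=> //; apply/forallP => z; apply/negP.
by move=> /andP[z0 za]; have := mina z; rewrite inE z0 za => /(_ isT).
Qed.

(** * The Galois connection *)

Lemma sub_filter (X : {set P}) x : x \in X -> x \in order_filter X.
Proof. by move=> xX; rewrite inE; apply/exists_inP; exists x. Qed.

Lemma antichain_bot A : \bot \in antichain_set A -> A = bottom_antichain.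
Proof.
move=> A0; apply/val_inj/setP => x; rewrite inE; apply/idP/eqP => [xA|->//].
have /forall_inP/(_ _ A0)/forall_inP/(_ x xA)/implyP := valP A.
by rewrite /Order.comparable le0x => /(_ isT)/eqP.
Qed.

(** The special treatment of [set0] and [{\bot}] agrees with the uniform
condition because nothing is linked to [\bot], and [\bot] belongs to no other
antichain. *)
Lemma mem_intersecters A x :
  (x \in intersecters A) = [forall a in antichain_set A, linked x a].
Proof.
rewrite inE /intersecter; case: eqP => [->|_].
  by apply/esym/forall_inP => a; rewrite inE.
case: eqP => [->|neq0].
  by apply/esym/forall_inP => /(_ \bot); rewrite inE linkedx0 => /(_ (eqxx _)).
apply: eq_forallb => a; rewrite in_setD1.
case: eqP => [->|_] /=.
  by apply/esym/implyP => /antichain_bot eqA; case: neq0; rewrite eqA.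
congr (_ ==> _); rewrite card_gt0; apply/set0Pn/exists_inP.
  by case=> b; rewrite !inE => /andP[/andP[bx ba] bA]; exists b; rewrite ?inE ?bx.
by case=> b bA bxa; exists b; rewrite in_setI bA !inE bxa.
Qed.

Lemma filter_blocker A : order_filter (blocker A) = intersecters A.
Proof.
rewrite order_filter_minset; apply/setP => x; apply/idP/idP => [|/sub_filter//].
rewrite inE => /exists_inP[y]; rewrite !mem_intersecters => /forall_inP yA yx.
by apply/forall_inP => a /yA; apply: linked_le.
Qed.

Lemma le_blockerP A B :
  reflect {in antichain_set A & antichain_set B, forall x y, linked x y}
          (A <= blocker B).
Proof.
rewrite antichain_leE Defs.filter_subset filter_blocker.
apply: (iffP forall_inP) => [lAB x y /lAB|lAB x xA].
  by rewrite mem_intersecters => /forall_inP lx /lx.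
by rewrite mem_intersecters; apply/forall_inP => y; apply: lAB.
Qed.

(** The left side is a condition on pairs of elements that is symmetric in the
two antichains.  Antitonicity, [blockerK] and [blockerU] follow from this
equality alone. *)
Lemma le_blockerC A B : (A <= blocker B) = (B <= blocker A).
Proof.
by apply/le_blockerP/le_blockerP => lAB x y xA yB; rewrite linkedC lAB.
Qed.

Lemma le_blocker2 A : A <= blocker (blocker A).
Proof. by rewrite le_blockerC. Qed.

Lemma blocker_anti A B : A <= B -> blocker B <= blocker A.
Proof. by move=> AB; rewrite le_blockerC (le_trans AB) ?le_blocker2. Qed.

Lemma blockerK A : blocker (blocker (blocker A)) = blocker A.
Proof. by apply/le_anti; rewrite le_blocker2 blocker_anti ?le_blocker2. Qed.

Lemma blockerU A B : blocker (A `|` B) = blocker A `&` blocker B.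
Proof.
apply/le_anti; rewrite lexI !blocker_anti ?leUl ?leUr //=.
by rewrite le_blockerC leUx le_blockerC leIl le_blockerC leIr.
Qed.

Lemma codom_blockerP B : reflect (blocker (blocker B) = B) (B \in codom blocker).
Proof.
apply: (iffP idP) => [/codomP[A ->]|<-]; first exact: blockerK.
exact: codom_f.
Qed.

Lemma codom_blockerI A B :
  A \in codom blocker -> B \in codom blocker -> A `&` B \in codom blocker.
Proof. by move=> /codomP[A' ->] /codomP[B' ->]; rewrite -blockerU codom_f. Qed.

(** * Extreme antichains *)

Lemma le_empty_antichain A : empty_antichain <= A.
Proof.
by rewrite antichain_leE Defs.filter_subset; apply/forall_inP => x; rewrite inE.
Qed.

Lemma le_bottom_antichain A : A <= bottom_antichain.
Proof.
rewrite antichain_leE; apply/subsetP => x _.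
by rewrite inE; apply/exists_inP; exists \bot; rewrite ?inE.
Qed.

Lemma le_atom_antichain A : A != bottom_antichain -> A <= atom_antichain.
Proof.
move=> A1; rewrite antichain_leE Defs.filter_subset; apply/forall_inP => x xA.
have [|a aA ax] := @ex_atom x; last by rewrite inE; apply/exists_inP; exists a.
by apply: contra A1 => /eqP x0; apply/eqP/antichain_bot; rewrite -x0.
Qed.

Lemma atom_antichain_neq_bottom :
  atom_antichain != bottom_antichain :> antichain P.
Proof.
apply/eqP => /(congr1 (fun A => \bot \in antichain_set A)).
by rewrite !inE /covers ltxx eqxx.
Qed.

Lemma blocker_empty : blocker empty_antichain = bottom_antichain :> antichain P.
Proof.
apply/le_anti; rewrite le_bottom_antichain le_blockerC.
exact: le_empty_antichain.
Qed.

Lemma blocker_bottom : blocker bottom_antichain = empty_antichain :> antichain P.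
Proof.
apply/le_anti; rewrite le_empty_antichain andbT antichain_leE filter_blocker.
apply/subsetP => x; rewrite mem_intersecters => /forall_inP/(_ \bot).
by rewrite inE linkedx0 => /(_ (eqxx _)).
Qed.

(** The greatest element of [P] is linked to every atom, so the atoms have at
least one intersecter. *)
Lemma blocker_atom_neq_empty :
  blocker atom_antichain != empty_antichain :> antichain P.
Proof.
apply/eqP => /(congr1 (fun A => \top \in order_filter (antichain_set A))).
rewrite filter_blocker mem_intersecters.
have -> : \top \in order_filter (set0 : {set P}) = false.
  by rewrite inE; apply/exists_inP => -[x]; rewrite inE.
move/forall_inP; case=> a aA.
by apply/exists_inP; exists a; rewrite ?lex1 ?lexx.
Qed.

(** The closure of the atoms is a blocker above the coatom of all antichains;
it would be the top only if the atoms had no intersecter. *)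
Lemma blocker2_atom :
  blocker (blocker atom_antichain) = atom_antichain :> antichain P.
Proof.
apply/le_anti; rewrite le_blocker2 andbT; apply: le_atom_antichain.
apply: contra blocker_atom_neq_empty => /eqP eq1.
by rewrite -blockerK eq1 blocker_bottom.
Qed.

(** * The poset of blockers *)

Implicit Types U V W : blockers P.

Lemma blocker_inK : involutive (fun U => blocker_in (val U)).
Proof. by move=> U; apply/val_inj/codom_blockerP/valP. Qed.

Lemma le_blocker_in U V : (blocker_in (val V) <= blocker_in (val U)) = (U <= V).
Proof.
apply/idP/idP => [/blocker_anti|/blocker_anti//].
by rewrite le_blockersE !(codom_blockerP _ (valP _)).
Qed.

Lemma self_dual_blockers : self_dual (blockers P).
Proof.
exists (fun U => blocker_in (val U)).
split; last by move=> U V; apply: le_blocker_in.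
by exists (fun U => blocker_in (val U)); apply: blocker_inK.
Qed.

Lemma blockers_meet U V :
  exists2 W, val W = val U `&` val V & is_meet U V W.
Proof.
have UV := codom_blockerI _ _ (valP U) (valP V).
exists (exist _ (val U `&` val V) UV : blockers P) => //.
split; rewrite ?le_blockersE /= ?leIl ?leIr // => W.
by rewrite !le_blockersE /= lexI => -> ->.
Qed.

Lemma blockers_join U V :
  is_join U V (blocker_in (blocker (val U) `&` blocker (val V))).
Proof.
split=> [||W UW VW]; rewrite le_blockersE /=.
- by rewrite le_blockerC leIl.
- by rewrite le_blockerC leIr.
(* The upper bound [W] is the blocker of [blocker (val W)], which lies below the
   meet of the two blockers. *)
rewrite -(codom_blockerP _ (valP W)); apply: blocker_anti.
by rewrite lexI !blocker_anti.
Qed.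

Lemma least_blockers : is_least (blocker_in bottom_antichain : blockers P).
Proof. by move=> U; rewrite le_blockersE /= blocker_bottom le_empty_antichain. Qed.

Lemma greatest_blockers : is_greatest (blocker_in empty_antichain : blockers P).
Proof. by move=> U; rewrite le_blockersE /= blocker_empty le_bottom_antichain. Qed.

Lemma atom_blockers U :
  covers (blocker_in bottom_antichain) U <-> U = blocker_in atom_antichain.
Proof.
apply: covers_least; first exact: least_blockers.
  rewrite lt_neqAle least_blockers andbT; apply: contra blocker_atom_neq_empty.
  by move=> /eqP/(congr1 val) /= <-; rewrite blocker_bottom.
(* Once [V] is written as the blocker of its own blocker, the bound is the image
   of [le_atom_antichain] under the antitone map. *)
move=> V; rewrite -[V]blocker_inK => neq0; apply/blocker_anti/le_atom_antichain.
by apply: contra neq0 => /eqP eq1; apply/eqP/val_inj; rewrite /= -eq1.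
Qed.

Lemma coatom_blockers U :
  covers U (blocker_in empty_antichain) <->
  U = blocker_in (blocker atom_antichain).
Proof.
apply: covers_greatest; first exact: greatest_blockers.
  rewrite lt_neqAle greatest_blockers andbT.
  apply: contra atom_antichain_neq_bottom => /eqP/(congr1 val) /=.
  by rewrite blocker2_atom blocker_empty => ->.
move=> V neq1; rewrite le_blockersE /= blocker2_atom; apply: le_atom_antichain.
by apply: contra neq1 => /eqP eq1; apply/eqP/val_inj; rewrite /= blocker_empty.
Qed.

End Blockers.

Theorem theorem5p3 (d : Order.disp_t) (P : finTBPOrderType d) (hP : (1 < #|P|)%N) :
  is_lattice (blockers P) /\
  (exists O I C : blockers P,
     [/\ val O = empty_antichain /\ is_least O,
         val I = bottom_antichain /\ is_greatest I,
         (forall B : blockers P, covers O B <-> B = blocker_in atom_antichain),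
         val C = atom_antichain &
         (forall B : blockers P, covers B I <-> B = C)]) /\
  (forall B1 B2 : antichain P,
     B1 \in codom blocker -> B2 \in codom blocker ->
     B1 `&` B2 \in codom blocker) /\
  self_dual (blockers P) /\
  (forall B1 B2 : blockers P,
     (exists2 M : blockers P, val M = val B1 `&` val B2 & is_meet B1 B2 M) /\
     is_join B1 B2 (blocker_in (blocker (val B1) `&` blocker (val B2)))).
Proof.
split; [move=> U V; split|].
- by have [W _] := blockers_meet U V; exists W.
- by eexists; apply: blockers_join.
split.
  exists (blocker_in bottom_antichain), (blocker_in empty_antichain).
  exists (blocker_in (blocker atom_antichain)); split.
  - by split; [exact: blocker_bottom | exact: least_blockers].
  - by split; [exact: blocker_empty | exact: greatest_blockers].
  - exact: atom_blockers.
  - exact: blocker2_atom.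
  - exact: coatom_blockers.
split; first exact: codom_blockerI.
split; first exact: self_dual_blockers.
by move=> U V; split; [exact: blockers_meet | exact: blockers_join].
Qed.
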